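(* Let $k\ge 1$. Every $(k+1)$-ary propositional inclusion atom is equivalent to some formula $\phi\in\mathcal{QPL}(\subseteq_k)_4$, that is, to a formula of quantified propositional logic extended with inclusion atoms, containing at most $4$ occurrences of inclusion atoms, each of arity at most $k$.
   Context: Let $\mathrm{Prop}$ be a countably infinite set of propositional symbols. Formulas of quantified propositional logic $\mathcal{QPL}$: $\phi::=p\mid\neg p\mid(\phi\wedge\phi)\mid(\phi\vee\phi)\mid\exists p\,\phi\mid\forall p\,\phi$ with $p\in\mathrm{Prop}$. $\mathrm{FV}(\phi)$ is the set of free propositional symbols. A team $T$ over a finite set of symbols $V=\mathrm{Var}(T)$ is a set of evaluations $s:V\to\{0,1\}$. For $\bar p=p_1\dots p_k$, $s(\bar p)=s(p_1)\dots s(p_k)$. $s(a/p)$ maps $p$ to $a$ and agrees with $s$ elsewhere. Semantics: $T\models p$ iff $s(p)=1$ for all $s\in T$; $T\models\neg p$ iff $s(p)=0$ for all $s\in T$; $T\models\phi\wedge\psi$ iff $T\models\phi$ and $T\models\psi$; $T\models\phi\vee\psi$ iff there are $S,S'\subseteq T$ with $S\cup S'=T$, $S\models\phi$, $S'\models\psi$; $T\models\exists p\,\phi$ iff there is $F:T\to\{\{0\},\{1\},\{0,1\}\}$ with $\{s(a/p)\mid s\in T,a\in F(s)\}\models\phi$; $T\models\forall p\,\phi$ iff $\{s(a/p)\mid s\in T,a\in\{0,1\}\}\models\phi$. Inclusion atom of arity $|\bar p|=|\bar q|$ (sequences of propositional symbols): $T\models\bar p\subseteq\bar q$ iff for all $s\in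 T$ there is $s'\in T$ with $s(\bar p)=s'(\bar q)$. $\mathcal{QPL}(\subseteq_k)_n$ is the set of formulas of the extension of $\mathcal{QPL}$ by (unnegated) inclusion atoms with at most $n$ occurrences of inclusion atoms, each of arity at most $k$. Equivalence $\phi\equiv\psi$ means $\mathrm{FV}(\phi)=\mathrm{FV}(\psi)$ and $T\models\phi\iff T\models\psi$ for every team $T$ with $\mathrm{FV}(\phi)\subseteq\mathrm{Var}(T)$. *)

(* Defs.v *)
From mathcomp Require Import all_boot.
From mathcomp Require Import finmap.

Set Implicit Arguments.
Unset Strict Implicit.
Unset Printing Implicit Defensive.

Local Open Scope fset_scope.

(* The countably infinite set of propositional symbols. *)
Notation symb := nat (only parsing).

Inductive formula : Type :=
| Pos of symb
| Neg of symb
| And of formula & formula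
| Or of formula & formula
| Ex of symb & formula
| All of symb & formula
| Incl (n : nat) (p q : n.-tuple symb).

Fixpoint FV (phi : formula) : {fset symb} :=
  match phi with
  | Pos p | Neg p => [fset p]
  | And f g | Or f g => FV f `|` FV g
  | Ex p f | All p f => FV f `\ p
  | Incl _ p q => [fset x in (p ++ q)%SEQ]
  end.

Definition eval (V : {fset symb}) := {ffun V -> bool}.
Definition team (V : {fset symb}) := {set {ffun V -> bool}}.

(* Junk value [false] outside [V]; [equivalent] below only considers teams whose
   domain contains the free symbols. *)
Definition value (V : {fset symb}) (s : eval V) (p : symb) : bool :=
  if insub p is Some x then s x else false.

(* s(a/p), whose domain is V extended with p *)
Definition update (V : {fset symb}) (s : eval V) (p : symb) (a : bool)
    : eval (p |` V) :=
  [ffun x : p |` V => if val x == p then a else value s (val x)].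

Fixpoint sat (phi : formula) (V : {fset symb}) (T : team V) : Prop :=
  match phi with
  | Pos p => forall s, s \in T -> value s p = true
  | Neg p => forall s, s \in T -> value s p = false
  | And f g => sat f T /\ sat g T
  | Or f g => exists S S' : team V,
      [/\ S \subset T, S' \subset T, S :|: S' = T, sat f S & sat g S']
  | Ex p f => exists F : eval V -> {set bool},
      (forall s, s \in T -> F s != set0) /\
      @sat f (p |` V) [set update s p a | s in T, a in F s]
  | All p f =>
      @sat f (p |` V) [set update s p a | s in T, a in [set: bool]]
  | Incl _ p q => forall s, s \in T ->
      exists2 s', s' \in T & map (value s) p = map (value s') q
  end.

Fixpoint incl_count (phi : formula) : nat :=
  match phi with
  | Pos _ | Neg _ => 0
  | And f g | Or f g => incl_count f + incl_count g
  | Ex _ f | All _ f => incl_count f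
  | Incl _ _ _ => 1
  end.

Fixpoint incl_arity_le (k : nat) (phi : formula) : bool :=
  match phi with
  | Pos _ | Neg _ => true
  | And f g | Or f g => incl_arity_le k f && incl_arity_le k g
  | Ex _ f | All _ f => incl_arity_le k f
  | Incl n _ _ => n <= k
  end.

(* The fragment QPL(\subseteq_k)_n *)
Definition QPL_incl (k n : nat) (phi : formula) : bool :=
  incl_arity_le k phi && (incl_count phi <= n).

Definition equivalent (phi psi : formula) : Prop :=
  FV phi = FV psi /\
  forall (V : {fset symb}) (T : team V),
    FV phi `<=` V -> (sat phi T <-> sat psi T).

(* Main.v *)
Require Import Defs.
From mathcomp Require Import all_boot.
From mathcomp Require Import finmap zify.

(** Write [p = p0 p1 p'] and [q = q0 q1 q']. The atom [p ⊆ q] says that, for each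
    of the four pairs of bits [ab], every value of [p'] taken where [p0 p1 = ab]
    is a value of [q'] taken where [q0 q1 = ab]. One flag bit is enough to
    express each of the four conditions: quantify a bit [z] universally and
    define [x := (p0 p1 = ab)], [y := z ∧ (q0 q1 = ab)] and
    [v := if z then q' else p']; then state [x p' ⊆ y v]. The rows with [z = 0]
    provide all tuples [0 p'], so that the atom constrains only the rows with
    [x = 1]. *)

Set Implicit Arguments.
Unset Strict Implicit.
Unset Printing Implicit Defensive.

(** * Quantifier-free formulas without inclusion atoms *)

Fixpoint classical (phi : formula) : bool :=
  match phi with
  | Pos _ | Neg _ => true
  | And f g | Or f g => classical f && classical g
  | _ => false
  end.

(* Junk value [false] on formulas that are not [classical]; likewise, [dual]
   is the negation of classical formulas only. *)
Fixpoint holds (nu : symb -> bool) (phi : formula) : bool :=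
  match phi with
  | Pos p => nu p
  | Neg p => ~~ nu p
  | And f g => holds nu f && holds nu g
  | Or f g => holds nu f || holds nu g
  | _ => false
  end.

Fixpoint dual (phi : formula) : formula :=
  match phi with
  | Pos p => Neg p
  | Neg p => Pos p
  | And f g => Or (dual f) (dual g)
  | Or f g => And (dual f) (dual g)
  | _ => phi
  end.

Lemma classical_dual phi : classical (dual phi) = classical phi.
Proof. by elim: phi => //= f -> g ->. Qed.

Lemma FV_dual phi : FV (dual phi) = FV phi.
Proof. by elim: phi => //= f -> g ->. Qed.

Lemma holds_dual nu phi :
  classical phi -> holds nu (dual phi) = ~~ holds nu phi.
Proof.
elim: phi => //= [p|f IHf g IHg|f IHf g IHg].
- by rewrite negbK.
- by move=> /andP[/IHf-> /IHg->]; rewrite negb_and.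
- by move=> /andP[/IHf-> /IHg->]; rewrite negb_or.
Qed.

Lemma eq_holds nu mu phi :
  {in FV phi, nu =1 mu} -> holds nu phi = holds mu phi.
Proof.
have sub f g : {in (FV f `|` FV g)%fset, nu =1 mu} ->
    {in FV f, nu =1 mu} /\ {in FV g, nu =1 mu}.
  by move=> H; split=> x xf; apply: H; rewrite inE xf ?orbT.
elim: phi => //= [p|p|f IHf g IHg|f IHf g IHg].
- by move=> ->; rewrite ?inE.
- by move=> ->; rewrite ?inE.
- by case/sub => /IHf-> /IHg->.
- by case/sub => /IHf-> /IHg->.
Qed.

Lemma incl_count_classical phi : classical phi -> incl_count phi = 0.
Proof. by elim: phi => //= f IHf g IHg /andP[/IHf-> /IHg->]. Qed.

Lemma incl_arity_le_classical k phi : classical phi -> incl_arity_le k phi.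
Proof. by elim: phi => //= f IHf g IHg /andP[/IHf-> /IHg->]. Qed.

(** Flatness. For a disjunction, the team is split into the rows that satisfy [f] and those that
    satisfy [g]; the two parts may overlap. *)
Lemma sat_classical phi (V : {fset symb}) (T : team V) : classical phi ->
  sat phi T <-> forall s, s \in T -> holds (value s) phi.
Proof.
elim: phi T => //= [p|f IHf g IHg|f IHf g IHg] T.
- by move=> _; split=> H s /H => [->|/negbTE].
- case/andP=> /IHf{}IHf /IHg{}IHg; split.
    by case=> /IHf Hf /IHg Hg s sT; rewrite Hf ?Hg.
  by move=> H; split; [apply/IHf|apply/IHg] => s /H /andP[].
- case/andP=> /IHf{}IHf /IHg{}IHg; split.
    case=> S [S' [_ _ <- /IHf Hf /IHg Hg]] s.
    by rewrite inE => /orP[/Hf->|/Hg->]; rewrite ?orbT.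
  move=> H; exists [set s in T | holds (value s) f],
                   [set s in T | holds (value s) g]; split.
  + by apply/subsetP=> s; rewrite inE => /andP[].
  + by apply/subsetP=> s; rewrite inE => /andP[].
  + apply/setP=> s; rewrite !inE -andb_orr.
    by case: (boolP (s \in T)) => //= /H ->.
  + by apply/IHf=> s; rewrite inE => /andP[].
  + by apply/IHg=> s; rewrite inE => /andP[].
Qed.

(** * Defining a symbol by existential quantification *)

Lemma value_update (V : {fset symb}) (s : eval V) p a n :
  value (update s p a) n = if n == p then a else value s n.
Proof.
rewrite {1}/value; case: insubP => [x _ <-|]; first by rewrite ffunE.
rewrite !inE negb_or => /andP[/negbTE-> nV].
by rewrite /value insubN.
Qed.

Lemma holds_update (V : {fset symb}) (s : eval V) p a phi :
  p \notin FV phi -> holds (value (update s p a)) phi = holds (value s) phi.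
Proof.
move=> pF; apply: eq_holds => n nF; rewrite value_update.
by case: eqP => // np; rewrite -np nF in pF.
Qed.

(** The first conjunct is [x] ↔ [a] in negation normal form, since only symbols can be negated. *)
Definition let_in (x : symb) (a f : formula) : formula :=
  Ex x (And (Or (And (Pos x) a) (And (Neg x) (dual a))) f).

(** By flatness, the biconditional forces every value in [F s] to be the truth value of [a] at [s].
    As [F s] is nonempty, it is that singleton, so quantifying [x] changes each row in exactly one
    way. Freshness of [x] for [a] ensures that the update does not disturb [a]. *)
Lemma sat_let_in x a f (V : {fset symb}) (T : team V) :
  classical a -> x \notin FV a ->
  sat (let_in x a f) T <->
  sat f [set update s x (holds (value s) a) | s in T].
Proof.
move=> ca xa.
rewrite /let_in; set D := Or _ _.
have cD : classical D by rewrite /= classical_dual ca.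
have hD s b : holds (value (update s x b)) D = (b == holds (value s) a).
  rewrite /= value_update eqxx holds_dual // holds_update //.
  by case: b (holds _ _) => [] [].
split.
  case=> F [F0 [/(sat_classical _ cD) HD]]; congr sat; apply/setP=> t.
  have HF s b : s \in T -> b \in F s -> b = holds (value s) a.
    by move=> sT bF; apply/eqP; rewrite -hD HD //; apply/imset2P; exists s b.
  apply/imset2P/imsetP => [[s b sT bF ->]|[s sT ->]].
    by exists s => //; rewrite (HF _ _ sT bF).
  have /set0Pn[b bF] := F0 _ sT.
  by exists s b => //; rewrite (HF _ _ sT bF).
move=> H; exists (fun s => [set holds (value s) a]); split.
  by move=> s _; apply/set0Pn; exists (holds (value s) a); rewrite inE.
have E : [set update s x b | s in T, b in [set holds (value s) a]] =
         [set update s x (holds (value s) a) | s in T].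
  apply/setP=> t; apply/imset2P/imsetP => [[s b sT /set1P-> ->]|[s sT ->]].
    by exists s.
  by exists s (holds (value s) a); rewrite ?inE.
rewrite E; split=> //; apply/(sat_classical _ cD) => _ /imsetP[s _ ->].
by rewrite hD.
Qed.

Lemma in_FV_let_in x a f n :
  (n \in FV (let_in x a f)) = (n != x) && ((n \in FV a) || (n \in FV f)).
Proof. by rewrite /= FV_dual !inE; case: eqP => //=; case: (n \in FV a). Qed.

(** * Several definitions at once *)

Definition lets (def : symb -> formula) (xs : seq symb) (f : formula) :=
  foldr (fun x => let_in x (def x)) f xs.

Section Lets.
Variables (def : symb -> formula) (xs : seq symb).
Hypothesis classical_def : {in xs, forall x, classical (def x)}.
(** No definition mentions a defined symbol, so nested definitions are all evaluated at the original
    row and amount to one simultaneous substitution. *)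
Hypothesis indep : {in xs &, forall x y, x \notin FV (def y)}.

Definition subst (ys : seq symb) (nu : symb -> bool) (n : symb) : bool :=
  if n \in ys then holds nu (def n) else nu n.

Lemma sat_lets_Incl n (p q : n.-tuple symb) (V : {fset symb}) (T : team V) :
  sat (lets def xs (Incl p q)) T <->
  forall s, s \in T -> exists2 s', s' \in T &
    map (subst xs (value s)) p = map (subst xs (value s')) q.
Proof.
elim: xs classical_def indep V T => [|x ys IH] cdef ind V T //.
have cx := cdef x (mem_head _ _).
have xx := ind x x (mem_head _ _) (mem_head _ _).
rewrite -[lets _ _ _]/(let_in x (def x) (lets def ys _)) sat_let_in // IH; first last.
- by move=> y z yys zys; apply: ind; rewrite inE ?yys ?zys orbT.
- by move=> y yys; apply: cdef; rewrite inE yys orbT.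
(* Setting [x] first does not affect the later definitions, which avoid [x]. *)
have E (s : eval V) :
    subst ys (value (update s x (holds (value s) (def x)))) =1
    subst (x :: ys) (value s).
  move=> m; rewrite /subst inE value_update.
  case: (boolP (m \in ys)) => my; rewrite ?orbT ?orbF.
    by rewrite holds_update //; apply: ind; rewrite inE ?eqxx ?my ?orbT.
  by case: eqP => // ->.
split=> H.
  move=> s sT; have /H[_ /imsetP[s' s'T ->]] := imset_f
    (fun s : eval V => update s x (holds (value s) (def x))) sT.
  by rewrite !(eq_map (E _)) => ?; exists s'.
move=> _ /imsetP[s sT ->]; have [s' s'T e] := H _ sT.
by exists (update s' x (holds (value s') (def x)));
  [apply: imset_f | rewrite !(eq_map (E _))].
Qed.

Lemma in_FV_lets f n :
  (n \in FV (lets def xs f)) =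
  (n \notin xs) && ((n \in FV f) || has (fun x => n \in FV (def x)) xs).
Proof.
elim: xs indep => [|x ys IH] ind; first by rewrite /= orbF.
rewrite -[lets _ _ _]/(let_in x (def x) (lets def ys f)) in_FV_let_in {}IH; last first.
  by move=> y z yys zys; apply: ind; rewrite inE ?yys ?zys orbT.
rewrite /= inE negb_or; case: eqP => //= _.
case: (boolP (n \in ys)) => [nys|_] /=; last by rewrite orbCA.
by rewrite orbF; apply/negbTE/ind; rewrite inE ?eqxx ?nys ?orbT.
Qed.

Lemma incl_count_lets f : incl_count (lets def xs f) = incl_count f.
Proof.
elim: xs classical_def => //= x ys IH cdef.
have cx := cdef x (mem_head _ _).
have cdx : classical (dual (def x)) by rewrite classical_dual.
rewrite -/(lets def ys f) !(incl_count_classical cx) !(incl_count_classical cdx) /=.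
rewrite IH // => y yys.
by apply: cdef; rewrite inE yys orbT.
Qed.

Lemma incl_arity_le_lets k f :
  incl_arity_le k (lets def xs f) = incl_arity_le k f.
Proof.
elim: xs classical_def => //= x ys IH cdef.
have cx := cdef x (mem_head _ _).
have cdx : classical (dual (def x)) by rewrite classical_dual.
rewrite -/(lets def ys f) !(incl_arity_le_classical k cx) !(incl_arity_le_classical k cdx) /=.
rewrite IH // => y yys.
by apply: cdef; rewrite inE yys orbT.
Qed.

End Lets.

(** * The inclusion condition for one pair of leading bits *)

Section FlaggedInclusion.
Variables (j : nat) (p0 p1 q0 q1 : symb) (p q : j.-tuple symb).

Let W : seq symb := [:: p0, p1 & p] ++ [:: q0, q1 & q].
(** All auxiliary symbols are taken consecutively from [m] on, so this one bound keeps them apart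
    from the symbols of the atom. *)
Let m : symb := (\max_(n <- W) n).+1.

Definition literal (a : bool) (n : symb) := if a then Pos n else Neg n.

(* With respect to the header, [m], [m + 1] and [m + 2] are [z], [x] and [y],
   and the symbols from [m + 3] on are [v]. *)
Definition flag_def (a b : bool) (n : symb) : formula :=
  match n - m with
  | 0 => Pos m
  | 1 => And (literal a p0) (literal b p1)
  | 2 => And (Pos m) (And (literal a q0) (literal b q1))
  | i.+3 => Or (And (Pos m) (Pos (nth 0 q i))) (And (Neg m) (Pos (nth 0 p i)))
  end.

(** The two leading bits give way to a single flag: the arity falls from [j.+2] to [j.+1]. *)
Definition flagged_incl (a b : bool) : formula :=
  All m (lets (flag_def a b) (iota m.+1 j.+2)
    (Incl [tuple of m.+1 :: p] [tuple of m.+2 :: [tuple m.+3 + i | i < j]])).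

Lemma fresh n : n \in W -> n < m.
Proof. by move=> nW; rewrite ltnS (leq_bigmax_seq (F := id)). Qed.

Lemma classical_flag_def a b n : classical (flag_def a b n).
Proof. by rewrite /flag_def; case: (n - m) a b => [|[|[|i]]] [] []. Qed.

Lemma FV_literal a n : FV (literal a n) = [fset n]%fset.
Proof. by case: a. Qed.

Lemma holds_literal nu a n : holds nu (literal a n) = (nu n == a).
Proof. by case: a => /=; case: (nu n). Qed.

Lemma FV_flag_def a b x n : x \in iota m.+1 j.+2 ->
  n \in FV (flag_def a b x) -> n = m \/ n \in W.
Proof.
rewrite mem_iota /flag_def => /andP[mx xj].
have : x - m < j.+3 by lia.
case: (x - m) => [|[|[|i]]] ij /=; rewrite ?FV_literal !inE.
- by move/eqP; left.
- by case/orP=> /eqP->; right; rewrite /W ?mem_cat !inE eqxx ?orbT.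
- by case/or3P=> /eqP->; [left|right|right]; rewrite // /W mem_cat !inE eqxx ?orbT.
- rewrite !ltnS in ij.
  case/orP=> /orP[] /eqP->; [by left | | by left |]; right.
    by rewrite /W mem_cat !inE mem_nth ?size_tuple ?orbT.
  by rewrite /W mem_cat !inE mem_nth ?size_tuple ?orbT.
Qed.

(** Definitions mention only [m] and symbols below it, while the defined symbols lie above [m]. *)
Lemma flag_def_indep a b :
  {in iota m.+1 j.+2 &, forall x y, x \notin FV (flag_def a b y)}.
Proof.
move=> x y; rewrite {1}mem_iota => /andP[mx _] yI.
by apply/negP => /(FV_flag_def yI)[|/fresh]; lia.
Qed.

(** Equivalence demands equal sets of free symbols. Nothing is lost: [p0], [p1] occur in the
    definition of x, [q0], [q1] in that of y, the entries of [q] in those of v, and the entries of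
    [p] in the atom itself. *)
Lemma FV_flagged_incl a b : FV (flagged_incl a b) = [fset n in W]%fset.
Proof.
apply/fsetP=> n; rewrite /flagged_incl; set xs := iota _ _; set f := Incl _ _.
have -> : (n \in FV (All m (lets (flag_def a b) xs f))) =
    (n != m) && (n \in FV (lets (flag_def a b) xs f)) by rewrite in_fsetD1.
rewrite in_FV_lets; last exact: flag_def_indep.
have -> : (n \in [fset x in W]%fset) = (n \in W) by exact: in_fset.
apply/and3P/idP => [[nm nI]|nW].
  case/orP; last first.
    by case/hasP=> x xI /(FV_flag_def xI)[nm'|//]; rewrite nm' eqxx in nm.
  rewrite !inE mem_cat !inE /=.
  have nfresh i : n = m.+1 + i -> i < j.+2 -> False.
    by move=> nE ij; move: nI; rewrite mem_iota; lia.
  case/or4P=> [/eqP nE|-> //|/eqP nE|/mapP[i _ nE]]; rewrite ?orbT //.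
  - by have := nfresh 0; lia.
  - by have := nfresh 1; lia.
  - by have := ltn_ord i; have := nfresh i.+2; lia.
have nm := fresh nW; split; [lia | by rewrite mem_iota; lia |].
have hasI i : i < j.+2 -> n \in FV (flag_def a b (m.+1 + i)) ->
    has (fun x => n \in FV (flag_def a b x)) (iota m.+1 j.+2).
  by move=> ij nF; apply/hasP; exists (m.+1 + i); rewrite // mem_iota; lia.
have flagE i : m.+1 + i - m = i.+1 by lia.
move: (nW); rewrite {1}/W mem_cat !in_cons -!orbA.
case/or4P=> [nE|nE|np|/or3P[nE|nE|nq]].
- by rewrite (hasI 0) ?orbT // /flag_def flagE /= !FV_literal !inE nE.
- by rewrite (hasI 0) ?orbT // /flag_def flagE /= !FV_literal !inE nE orbT.
- by rewrite in_fset mem_cat inE np orbT.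
- by rewrite (hasI 1) ?orbT // /flag_def flagE /= !FV_literal !inE nE ?orbT.
- by rewrite (hasI 1) ?orbT // /flag_def flagE /= !FV_literal !inE nE ?orbT.
(* The entry of v that mentions [n] is [m.+3 + index n q]; the offset 2 from [m.+1] skips x and
   y. *)
- have ij : index n q < j by rewrite -{2}(size_tuple q) index_mem.
  rewrite (hasI (index n q).+2) ?orbT // /flag_def flagE /= !inE.
  by rewrite nth_index // eqxx orbT.
Qed.

Lemma incl_count_flagged_incl a b : incl_count (flagged_incl a b) = 1.
Proof.
exact: (incl_count_lets (fun x (_ : x \in iota m.+1 j.+2) =>
  classical_flag_def a b x) (Incl _ _)).
Qed.

Lemma incl_arity_le_flagged_incl a b : incl_arity_le j.+1 (flagged_incl a b).
Proof.
apply: etrans (incl_arity_le_lets (fun x (_ : x \in iota m.+1 j.+2) =>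
  classical_flag_def a b x) _ (Incl _ _)) _; exact: leqnn.
Qed.

Lemma map_subst_left a b nu :
  map (subst (flag_def a b) (iota m.+1 j.+2) nu) (m.+1 :: p) =
  ((nu p0 == a) && (nu p1 == b)) :: map nu p.
Proof.
congr cons.
  by rewrite /subst mem_iota leqnn ifT; [|lia];
     rewrite /flag_def subSnn /= !holds_literal.
apply/eq_in_map=> n np; have : n < m.
  by apply: fresh; rewrite /W mem_cat !inE np !orbT.
by rewrite /subst mem_iota => nm; rewrite ifF //; lia.
Qed.

Lemma map_subst_right a b nu :
  map (subst (flag_def a b) (iota m.+1 j.+2) nu)
    (m.+2 :: [tuple m.+3 + i | i < j]) =
  (nu m && ((nu q0 == a) && (nu q1 == b))) ::
    (if nu m then map nu q else map nu p).
Proof.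
congr cons.
  rewrite /subst mem_iota ifT; last by lia.
  have -> : flag_def a b m.+2 = And (Pos m) (And (literal a q0) (literal b q1)).
    by rewrite /flag_def (_ : m.+2 - m = 2) //; lia.
  by rewrite /= !holds_literal.
have -> : (if nu m then map nu q else map nu p) =
          [seq (if nu m then nu (tnth q i) else nu (tnth p i)) | i <- enum 'I_j].
  have E (r : j.-tuple symb) : map nu r = [seq nu (tnth r i) | i <- enum 'I_j].
    by rewrite -{1}(map_tnth_enum r) -map_comp.
  by case: (nu m); apply: E.
rewrite -[LHS]/(map _ [seq m.+3 + i | i : 'I_j]) -map_comp.
apply: eq_map => i; have ij := ltn_ord i.
rewrite -[LHS]/(subst _ (iota m.+1 j.+2) nu (m.+3 + i)).
rewrite /subst mem_iota ifT; last by lia.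
rewrite /flag_def (_ : m.+3 + i - m = i.+3); last by lia.
by rewrite /= -!tnth_nth; case: (nu m); rewrite ?orbF.
Qed.

Lemma sat_flagged_incl a b (V : {fset symb}) (T : team V) :
  sat (flagged_incl a b) T <->
  forall s, s \in T -> value s p0 = a -> value s p1 = b ->
    exists s', [/\ s' \in T, value s' q0 = a, value s' q1 = b &
      map (value s) p = map (value s') q].
Proof.
pose X := [set update s m c | s in T, c in [set: bool]].
rewrite -[sat _ T]/(sat (lets (flag_def a b) (iota m.+1 j.+2) (Incl _ _)) X).
rewrite sat_lets_Incl; first last.
- exact: flag_def_indep.
- by move=> x _; apply: classical_flag_def.
have upd (s : eval V) c : {in W, value (update s m c) =1 value s}.
  by move=> n /fresh nm; rewrite value_update ifF //; lia.
have updm (s : eval V) c : value (update s m c) m = c.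
  by rewrite value_update eqxx.
have inp n : n \in p -> n \in W by rewrite /W mem_cat !inE => ->; rewrite !orbT.
have inq n : n \in q -> n \in W by rewrite /W mem_cat !inE => ->; rewrite !orbT.
have mapp (s : eval V) c : map (value (update s m c)) p = map (value s) p.
  by apply/eq_in_map => n /inp; apply: upd.
have mapq (s : eval V) c : map (value (update s m c)) q = map (value s) q.
  by apply/eq_in_map => n /inq; apply: upd.
have Wbits : [/\ p0 \in W, p1 \in W, q0 \in W & q1 \in W].
  by rewrite /W !mem_cat !inE !eqxx !orbT.
case: Wbits => p0W p1W q0W q1W.
have XI (s : eval V) c : s \in T -> update s m c \in X.
  by move=> sT; apply/imset2P; exists s c; rewrite ?inE.
split=> H.
  (* The choice z = 1 on the left is arbitrary, since neither x nor [p] depends on z. *)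
  move=> s sT sa sb; have [_ /imset2P[s' c s'T _ ->]] := H _ (XI s true sT).
  rewrite map_subst_left map_subst_right updm mapp mapq mapp !upd // sa sb !eqxx.
  (* The flag x is 1 here, so y is 1 at the matching row. This forces z = 1 there, hence v reads
     [q], and the leading bits of [s'] are [a] and [b]. *)
  case: c => [] [] // /esym/andP[/eqP s'a /eqP s'b] e.
  by exists s'; split.
move=> _ /imset2P[s c sT _ ->].
have [/andP[/eqP sa /eqP sb]|/negbTE sN] :=
    boolP ((value s p0 == a) && (value s p1 == b)).
  have [s' [s'T s'a s'b e]] := H _ sT sa sb.
  exists (update s' m true); first exact: XI.
  by rewrite map_subst_left map_subst_right updm mapp mapq !upd // sa sb s'a
    s'b !eqxx e.
(* With x = 0, the row itself with z = 0 is a match: there y = 0 and v reads [p]. *)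
exists (update s m false); first exact: XI.
by rewrite map_subst_left map_subst_right updm !mapp !upd // sN.
Qed.

End FlaggedInclusion.

(** * Conjunction over the four pairs of bits *)

Theorem proposition4p2 (k : nat) (hk : 1 <= k) (p q : (k.+1).-tuple symb) :
  exists phi : formula, QPL_incl k 4 phi /\ equivalent (Incl p q) phi.
Proof.
(* As [k] is positive, the tuples have length [j.+2] and two leading bits can be split off. *)
case: k hk p q => // j _ p q.
case/tupleP: p => p0 p; case/tupleP: p => p1 p.
case/tupleP: q => q0 q; case/tupleP: q => q1 q.
pose f := flagged_incl p0 p1 q0 q1 p q.
have count_f a b : incl_count (f a b) = 1 by apply: incl_count_flagged_incl.
have arity_f a b : incl_arity_le j.+1 (f a b).
  exact: incl_arity_le_flagged_incl.
have FV_f := FV_flagged_incl p0 p1 q0 q1 p q.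
have sat_f := sat_flagged_incl p0 p1 q0 q1 p q.
rewrite -/f in FV_f sat_f; clearbody f.
exists (And (And (f false false) (f false true))
            (And (f true false) (f true true))); split.
  by rewrite /QPL_incl /= !count_f !arity_f.
split; first by rewrite [RHS]/= !FV_f !fsetUid.
move=> V T _; split.
  move=> H.
  suff fab a b : sat (f a b) T by split; split; apply: fab.
  apply/sat_f => s sT sa sb.
  by have [s' s'T /= [e0 e1 e]] := H _ sT; exists s'; split; rewrite -?e0 -?e1.
case=> [[H00 H01] [H10 H11]] s sT.
(* The conjunct that constrains [s] is the one indexed by the leading bits of [s] itself. *)
have /sat_f /(_ s sT erefl erefl)[s' [s'T e0 e1 e]] :
    sat (f (value s p0) (value s p1)) T.
  by case: (value s p0) (value s p1) => [] [].
by exists s' => //=; rewrite e0 e1 e.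
Qed.
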